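(* Let $\hat p$ be an arbitrary distribution model and let $\{\hat{\mathbf{x}},\hat r\}$ be the corresponding expectation model, i.e. $\hat{\mathbf{x}}(\boldsymbol\phi,a)=\sum_{\boldsymbol\phi',r}\boldsymbol\phi'\,\hat p(\boldsymbol\phi',r\mid\boldsymbol\phi,a)$ and $\hat r(\boldsymbol\phi,a)=\sum_{\boldsymbol\phi',r}r\,\hat p(\boldsymbol\phi',r\mid\boldsymbol\phi,a)$. Suppose the approximate value function is linear in the feature vector, $\hat v(\boldsymbol\phi,\mathbf{w})=\boldsymbol\phi^\top\mathbf{w}$. Then, for every policy $\pi$, every feature vector $\boldsymbol\phi$, every weight vector $\mathbf{w}\in\mathbb{R}^m$ and every $\gamma\in[0,1)$, the approximate-dynamic-programming (policy evaluation) update target computed with the distribution model equals that computed with the expectation model: $$\sum_a\pi(a\mid\boldsymbol\phi)\sum_{\boldsymbol\phi',r}\hat p(\boldsymbol\phi',r\mid\boldsymbol\phi,a)\bigl[r+\gamma\hat v(\boldsymbol\phi',\mathbf{w})\bigr]=\sum_a\pi(a\mid\boldsymbol\phi)\bigl[\hat r(\boldsymbol\phi,a)+\gamma\,\hat{\mathbf{x}}(\boldsymbol\phi,a)^\top\mathbf{w}\bigr].$$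
   Context: The underlying MDP is finite, so there are finitely many actions $a\in\mathcal{A}$, rewards $r\in\mathcal{R}\subset\mathbb{R}$, and feature vectors in $\mathbb{R}^m$. A distribution model $\hat p$ assigns to each feature vector $\boldsymbol\phi$ and action $a$ a probability distribution $\hat p(\cdot,\cdot\mid\boldsymbol\phi,a)$ over pairs (next feature vector $\boldsymbol\phi'$, reward $r$). A policy $\pi(\cdot\mid\boldsymbol\phi)$ is a probability distribution over actions for each feature vector $\boldsymbol\phi$. Approximate dynamic programming for policy evaluation updates $\mathbf{w}$ for each $\boldsymbol\phi$ so that $\hat v(\boldsymbol\phi,\mathbf{w})$ is moved toward the update target displayed in the claim. *)

(* Defs.v *)
From mathcomp Require Import all_boot all_order all_algebra.
From mathcomp Require Import finmap reals.

Set Implicit Arguments.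
Unset Strict Implicit.
Unset Printing Implicit Defensive.

Import Order.TTheory GRing.Theory Num.Theory.
Local Open Scope fset_scope.
Local Open Scope ring_scope.

Record fin_dist (R : realType) (T : finType) := FinDist {
  fin_dist_pmf :> T -> R;
  fin_dist_ge0 : forall t, 0 <= fin_dist_pmf t;
  fin_dist_sum1 : \sum_t fin_dist_pmf t = 1 }.

(* The feature vectors and the rewards of the finite MDP form finite sets
   [Phi] and [Rew], used below as finite types through the coercion of
   [{fset K}] to [finType]; [fsval] is the inclusion into R^m, resp. R. *)
Definition policy (R : realType) (m : nat) (A : finType)
    (Phi : {fset 'cV[R]_m}) : Type :=
  Phi -> fin_dist R A.

Definition distribution_model (R : realType) (m : nat) (A : finType)
    (Phi : {fset 'cV[R]_m}) (Rew : {fset R}) : Type :=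
  Phi -> A -> fin_dist R (Phi * Rew)%type.

Definition expected_feature (R : realType) (m : nat) (A : finType)
    (Phi : {fset 'cV[R]_m}) (Rew : {fset R})
    (p : distribution_model A Phi Rew) (phi : Phi) (a : A) : 'cV[R]_m :=
  \sum_(phi' : Phi) \sum_(r : Rew) p phi a (phi', r) *: fsval phi'.

Definition expected_reward (R : realType) (m : nat) (A : finType)
    (Phi : {fset 'cV[R]_m}) (Rew : {fset R})
    (p : distribution_model A Phi Rew) (phi : Phi) (a : A) : R :=
  \sum_(phi' : Phi) \sum_(r : Rew) fsval r * p phi a (phi', r).

(* [x^T *m w] is a 1 x 1 matrix; its only entry is the real number x^T w. *)
Definition inner (R : realType) (m : nat) (x w : 'cV[R]_m) : R :=
  (x^T *m w) 0 0.

(* Main.v *)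
Require Import Defs.
From mathcomp Require Import all_boot all_order all_algebra.
From mathcomp Require Import finmap reals.

Import Order.TTheory GRing.Theory Num.Theory.
Local Open Scope fset_scope.
Local Open Scope ring_scope.

(** For each action, the bracket [r + gamma * inner phi' w] is linear in the pair [(phi', r)], so
    averaging it over the model's outcomes gives its value at the averaged pair. Linearity of
    [inner] in its first argument, [inner_suml] and [inner_scalel], carries this. *)

Lemma inner_suml (R : realType) (m : nat) (I : finType) (x : I -> 'cV[R]_m)
    (w : 'cV[R]_m) :
  inner (\sum_i x i) w = \sum_i inner (x i) w.
Proof. by rewrite /inner linear_sum mulmx_suml summxE. Qed.

Lemma inner_scalel (R : realType) (m : nat) (c : R) (x w : 'cV[R]_m) :
  inner (c *: x) w = c * inner x w.
Proof. by rewrite /inner linearZ -scalemxAl mxE. Qed.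

Theorem mainTheorem4 (R : realType) (m : nat) (A : finType)
  (Phi : {fset 'cV[R]_m}) (Rew : {fset R})
  (p : distribution_model A Phi Rew)
  (vhat : 'cV[R]_m -> 'cV[R]_m -> R)
  (vhat_linear : forall x w : 'cV[R]_m, vhat x w = inner x w)
  (pi : policy A Phi) (phi : Phi) (w : 'cV[R]_m)
  (gamma : R) (gamma_ge0 : 0 <= gamma) (gamma_lt1 : gamma < 1) :
  \sum_(a : A) pi phi a *
    (\sum_(phi' : Phi) \sum_(r : Rew)
       p phi a (phi', r) * (fsval r + gamma * vhat (fsval phi') w))
  = \sum_(a : A) pi phi a *
    (expected_reward p phi a + gamma * inner (expected_feature p phi a) w).
Proof.
apply: eq_bigr => a _; congr (_ * _).
(* Reward and feature sums merge into one sum over [phi'], then over [r], so both sides can be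
   compared outcome by outcome. *)
rewrite /expected_reward /expected_feature inner_suml mulr_sumr -big_split /=.
apply: eq_bigr => phi' _.
rewrite inner_suml mulr_sumr -big_split /=.
apply: eq_bigr => r _.
(* For a single outcome only distributivity and commutativity in [R] remain. *)
by rewrite vhat_linear inner_scalel mulrDr mulrC [gamma * (_ * _)]mulrCA.
Qed.
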